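(* Let $\mathcal{C}$ be an admissible line complex in $\mathbb{Z}_2^4$ consisting of exactly $16$ lines. Then the graph $G(\mathcal{C})$ can be obtained by taking a disjoint union of one or more odd cycles and attaching (possibly trivial) trees to the cycle vertices; that is, each connected component of $G(\mathcal{C})$ consists of a single odd cycle with trees attached to its vertices.
   Context: An affine line in $\mathbb{Z}_2^4$ is a set $\{x, x+v\}$ with $x \in \mathbb{Z}_2^4$ and $v \in \mathbb{Z}_2^4 \setminus \{0\}$; thus lines are exactly the unordered pairs of distinct points of $\mathbb{Z}_2^4$. A line complex is a subset $\mathcal{C}$ of the set of all lines. For $f \colon \mathbb{Z}_2^4 \to \mathbb{C}$ and a line $L$, $Rf(L) = \sum_{x \in L} f(x)$, and $R_{\mathcal{C}} f = (Rf(L))_{L \in \mathcal{C}}$. The complex $\mathcal{C}$ is admissible if the linear map $R_{\mathcal{C}} \colon \mathbb{C}^{\mathbb{Z}_2^4} \to \mathbb{C}^{\mathcal{C}}$ is injective. The graph $G(\mathcal{C})$ has vertex set $\mathbb{Z}_2^4$, and two distinct vertices $x,y$ are adjacent iff $\{x,y\} \in \mathcal{C}$. A cycle is a simple closed path (of length at least 3); it is odd if its length is odd. A connected graph $H$ ''consists of a single odd cycle with trees attached to its vertices'' if $H$ contains exactly one cycle, that cycle $C$ has odd length, and deleting the edges of $C$ from $H$ leaves a forest each of whose components is a tree containing exactly one vertex of $C$ (the tree may be that single vertex). *)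

(* Defs.v *)
From mathcomp Require Import all_boot all_order all_algebra.
From mathcomp Require Import reals complex.

Set Implicit Arguments.
Unset Strict Implicit.
Unset Printing Implicit Defensive.

Import GRing.Theory.
Local Open Scope ring_scope.

(* A finite simple graph is given by a vertex set V and a set E of unordered
   pairs of distinct elements of V.  Notions that do not depend on V (when every
   edge lies in V) only take E as argument. *)
Section Graphs.
Variable T : finType.
Implicit Types (V K : {set T}) (E : {set {set T}}) (c : seq T).

Definition adj E : rel T := [rel x y | (x != y) && ([set x; y] \in E)].

Definition connected V E : Prop :=
  V != set0 /\ {in V &, forall x y, connect (adj E) x y}.

Definition components V E : {set {set T}} :=
  equivalence_partition (connect (adj E)) V.

(* The last vertex of c is adjacent to the first one. *)
Definition is_cycle E c : bool :=
  [&& (2 < size c)%N, cycle (adj E) c & uniq c].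

Definition cycle_edges c : {set {set T}} := [set [set x; next c x] | x in c].

Definition acyclic E : Prop := forall c, ~~ is_cycle E c.

Definition is_tree V E : Prop := connected V E /\ acyclic E.

(* A cycle, as a subgraph, corresponds to several sequences (the choice of a
   starting point and of a direction); two sequences denote the same cycle iff
   they have the same edges. *)
Definition unique_cycle E c : Prop :=
  is_cycle E c /\ forall c', is_cycle E c' -> cycle_edges c' = cycle_edges c.

(* [E ::&: K] is the set of the edges in E that are included in K. *)
Definition odd_cycle_with_trees V E : Prop :=
  connected V E /\
  exists c, [/\ unique_cycle E c, odd (size c),
    acyclic (E :\: cycle_edges c)
  & forall K, K \in components V (E :\: cycle_edges c) ->
      is_tree K ((E :\: cycle_edges c) ::&: K)
      /\ #|K :&: [set x in c]| = 1%N].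

End Graphs.

Definition point : finType := 'rV['Z_2]_4.

Definition lines : {set {set point}} :=
  [set L | [exists x : 'rV['Z_2]_4, exists v : 'rV['Z_2]_4,
              (v != 0) && (L == [set x; x + v])]].

Definition radon (R : realType) (C : {set {set point}})
    (f : {ffun point -> R[i]}) : {ffun {L : {set point} | L \in C} -> R[i]} :=
  [ffun L : {L : {set point} | L \in C} => \sum_(x in val L) (f x : R[i])].

Definition admissible (R : realType) (C : {set {set point}}) : Prop :=
  injective (@radon R C).

(* Main.v *)
Require Import Defs.
From mathcomp Require Import all_boot all_order all_algebra.
From mathcomp Require Import reals complex.
From mathcomp Require Import zify.

(** Two facts combine.

    Every component K of G(C) contains an odd cycle. Otherwise K is bipartite,
    and the function that is 1 on one side of K, -1 on the other side and 0
    outside K sums to zero on every line of C, against injectivity. The two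
    sides are read off from the bipartite double cover of the graph: a point x
    is on the even (odd) side when it is the end of a walk of even (odd) length
    from a base point r. The function 'even side minus odd side' is always in
    the kernel, so it vanishes at r, which yields a closed walk of odd length
    at r (admissible_cover), and such a walk contains an odd cycle
    (odd_closed_walk).

    Every component K has exactly as many edges as vertices. All of the
    counting rests on card_reaches: if every vertex of V can be joined to a
    vertex of S by edges of E, then #|V| <= #|E| + #|S|. Applied to the edges
    outside a cycle of K, with the vertices of the cycle as S, it shows that K
    has at least #|K| edges. As there are 16 lines for 16 points, equality holds
    in each component (component_edges_le).

    A connected graph with as many edges as vertices leaves no slack in this
    count, and this forces its shape. If it had a second cycle, an edge of one
    cycle outside the other could be deleted without disconnecting the graph,
    which would then have fewer edges than vertices and still contain a cycle.
    If two vertices of the cycle were joined by edges outside the cycle, one of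
    them could be dropped from S. *)

Set Implicit Arguments.
Unset Strict Implicit.
Unset Printing Implicit Defensive.

(** * Edges, components and restrictions *)

Section GraphTheory.
Variable T : finType.
Implicit Types (V K S : {set T}) (E D : {set {set T}}) (c p : seq T).

Lemma adjE E x y : adj E x y = (x != y) && ([set x; y] \in E).
Proof. by []. Qed.

Lemma adj_sym E : symmetric (adj E).
Proof. by move=> x y; rewrite !adjE eq_sym setUC. Qed.

Lemma connect_adj_sym E : connect_sym (adj E).
Proof. exact/sym_connect_sym/adj_sym. Qed.

Lemma connect_adj_equiv E V :
  {in V & &, equivalence_rel (connect (adj E))}.
Proof.
move=> x y z _ _ _; split=> // cxy.
exact: (same_connect (connect_adj_sym E) cxy).
Qed.

Lemma adj_subset D E : D \subset E -> subrel (adj D) (adj E).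
Proof.
by move=> /subsetP sDE x y /andP[ne xyD]; rewrite adjE ne sDE.
Qed.

Lemma is_cycle_subset D E c : D \subset E -> is_cycle D c -> is_cycle E c.
Proof.
move=> sDE /and3P[sz cyc uc]; rewrite /is_cycle sz uc andbT /=.
exact: sub_cycle (adj_subset sDE) _ cyc.
Qed.

Lemma components_partition V E : partition (components V E) V.
Proof. exact/equivalence_partitionP/connect_adj_equiv. Qed.

Lemma component_closed V E K :
    E \subset powerset V -> K \in components V E ->
  forall x y, x \in K -> adj E x y -> y \in K.
Proof.
move=> /subsetP EV /imsetP[r rV ->] x y; rewrite !inE.
move=> /andP[xV rx] axy; have /andP[_ /EV] := axy.
rewrite inE subUset !sub1set => /andP[_ ->] /=.
exact: connect_trans rx (connect1 axy).
Qed.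

Lemma path_restrict E K x p :
    (forall x y, x \in K -> adj E x y -> y \in K) ->
  x \in K -> path (adj E) x p -> path (adj (E ::&: K)) x p.
Proof.
move=> Kcl; elim: p x => //= y p IHp x xK /andP[axy pyp].
have yK := Kcl _ _ xK axy.
rewrite IHp // andbT; move: axy => /andP[xy xyE].
by rewrite adjE xy !inE xyE subUset !sub1set xK yK.
Qed.

Lemma component_connected V E K :
  E \subset powerset V -> K \in components V E -> connected K (E ::&: K).
Proof.
move=> EV KVE; split.
  have /and3P[_ _ n0] := components_partition V E.
  by apply: contraNneq n0 => <-.
move=> x y xK yK.
have : connect (adj E) x y.
  move: KVE xK yK => /imsetP[r rV ->]; rewrite !inE.
  move=> /andP[_ rx] /andP[_]; apply: connect_trans.
  by rewrite connect_adj_sym.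
move=> /connectP[p pxp ->]; apply/connectP; exists p => //.
exact: path_restrict (component_closed EV KVE) xK pxp.
Qed.

(** * Counting edges by reachability *)

(** Stop the walk at its first vertex in S: no earlier edge lies inside S, so
    none of the edges in D has been used. *)
Lemma reach_avoiding E D S x y :
    D \subset powerset S -> y \in S -> connect (adj E) x y ->
  exists2 z, z \in S & connect (adj (E :\: D)) x z.
Proof.
move=> /subsetP DS yS /connectP[p pxp eq_y].
elim: p x pxp eq_y => [|x' p IHp] x /=; first by move=> _ <-; exists y.
case/andP=> axx' px'p eq_y.
have [xS|xS] := boolP (x \in S); first by exists x.
have [z zS cz] := IHp _ px'p eq_y; exists z => //.
apply: connect_trans cz; apply: connect1.
have /andP[ne xE] := axx'; rewrite adjE ne inE xE andbT /=.
by apply: contra xS => /DS; rewrite inE subUset !sub1set => /andP[].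
Qed.

Definition reaches V E S :=
  forall x, x \in V -> exists2 s, s \in S & connect (adj E) x s.

(** S grows one vertex at a time, along an edge [a; b] entering S. That edge is
    paid for by the new vertex a and may be deleted, since a walk to S that uses
    it can stop at a instead. *)
Lemma card_reaches V E S : reaches V E S -> #|V| <= #|E| + #|S|.
Proof.
have [n] := ubnP #|~: S|; elim: n E S => // n IHn E S ltn VS.
have [sVS|/subsetPn[x xV xS]] := boolP (V \subset S).
  by rewrite (leq_trans (subset_leq_card sVS)) ?leq_addl.
have [a [b [aS bS aab]]] : exists a b, [/\ a \notin S, b \in S & adj E a b].
  have [s sS /connectP[p]] := VS x xV.
  elim: p x xS {xV} => [|y p IHp] x xS /=.
    by move=> _ eqs; rewrite -eqs sS in xS.
  case/andP=> axy pyp eqs.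
  by have [yS|yS] := boolP (y \in S); [exists x, y | apply: IHp eqs].
pose e := [set a; b]; have /andP[_ eE] := aab.
have : #|V| <= #|E :\: [set e]| + #|a |: S|.
  apply: IHn => [|z /VS[s sS]].
    have := cardsC S; have := cardsC (a |: S); rewrite cardsU1 aS; lia.
  apply: reach_avoiding; last by rewrite inE sS orbT.
  by rewrite sub1set inE subUset !sub1set !inE eqxx bS orbT.
by rewrite (cardsD1 e E) eE cardsU1 aS addnCA addnA.
Qed.

(** * Edges of a cycle *)

Lemma next_next_neq c x :
  uniq c -> 2 < size c -> x \in c -> next c (next c x) != x.
Proof.
move=> uc sz xc; have [i p def_c] := rot_to xc.
move: (uc) sz; rewrite -!(next_rot i uc) -(rot_uniq i) -(size_rot i) def_c.
case: p {def_c} => [|y [|z p]] //=; rewrite !inE !eqxx.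
case/and3P=> /norP[/negPf xy /norP[/negPf xz _]] _ _ _.
by rewrite [y == x]eq_sym xy eq_sym xz.
Qed.

(** Vertices x != y with the same edge {x, next x} = {y, next y} would be each
    other's successor, which takes a cycle of length 2. *)
Lemma card_cycle_edges E c : is_cycle E c -> #|cycle_edges c| = size c.
Proof.
case/and3P=> sz _ uc.
rewrite card_in_imset ?(card_uniqP uc) // => x y xc yc eqe.
have : x \in [set y; next c y] by rewrite -eqe !inE eqxx.
have : y \in [set x; next c x] by rewrite eqe !inE eqxx.
rewrite !inE => /orP[/eqP-> //|/eqP yx] /orP[/eqP-> //|/eqP xy].
by have := next_next_neq uc sz xc; rewrite -yx -xy eqxx.
Qed.

Lemma cycle_edges_subset E c : is_cycle E c -> cycle_edges c \subset E.
Proof.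
case/and3P=> _ cyc _; apply/subsetP=> _ /imsetP[x xc ->].
by have /andP[] := next_cycle cyc xc.
Qed.

Lemma cycle_edges_powerset c :
  cycle_edges c \subset powerset [set x in c].
Proof.
apply/subsetP=> _ /imsetP[x xc ->].
by rewrite inE subUset !sub1set !inE mem_next xc.
Qed.

Lemma cycle_vertices_subset V E c :
  E \subset powerset V -> is_cycle E c -> {subset c <= V}.
Proof.
move=> /subsetP EV /cycle_edges_subset/subsetP cE x xc.
have /cE/EV : [set x; next c x] \in cycle_edges c by apply: imset_f.
by rewrite inE subUset !sub1set => /andP[].
Qed.

Lemma is_cycle_head E c : is_cycle E c -> exists x, x \in c.
Proof. by case: c => // x c _; exists x; rewrite mem_head. Qed.

Lemma path_avoid E x y z p :
  y \notin z :: p -> path (adj E) z p ->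
  path (adj (E :\ [set x; y])) z p.
Proof.
elim: p z => //= t p IHp z; rewrite inE negb_or => /andP[yz yp].
case/andP=> /andP[ne ztE] /IHp -> //; rewrite andbT adjE ne !inE ztE andbT /=.
apply: contra yz => /eqP eqe.
have : y \in [set z; t] by rewrite eqe !inE eqxx orbT.
by move: yp; rewrite !inE negb_or => /andP[/negPf-> _]; rewrite orbF.
Qed.

(** The ends of a deleted edge {x, y} of a cycle remain joined by the rest of
    the cycle. *)
Lemma cycle_edge_removal E c e :
    is_cycle E c -> e \in cycle_edges c ->
  subrel (connect (adj E)) (connect (adj (E :\ e))).
Proof.
move=> /and3P[sz cyc uc] /imsetP[x xc ->].
have [i p def_c] := rot_to xc.
move: sz cyc uc (uc); rewrite -(size_rot i) -(rot_cycle i) -{1}(rot_uniq i).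
move=> + + + uc; rewrite -(next_rot i uc) def_c.
case: p {def_c} => [|y [|z p]] //= _; rewrite eqxx.
case/and3P=> _ /andP[yz yzE] azp /and3P[].
rewrite !inE !negb_or => /and3P[xy xz _] /andP[_ yp] _.
(* The cycle is now x, y, z, ...; follow it from y through z back to x. *)
have cyx : connect (adj (E :\ [set x; y])) y x.
  apply/connectP; exists (z :: rcons p x); last by rewrite /= last_rcons.
  rewrite /= adjE yz !inE yzE andbT path_avoid ?andbT //.
    apply: contra xz => /eqP/setP/(_ z); rewrite !inE eqxx orbT.
    by rewrite [z == y]eq_sym (negPf yz) orbF eq_sym => <-.
  by rewrite inE mem_rcons inE eq_sym !negb_or [y == x]eq_sym xy eq_sym yz.
apply: connect_sub => a b aab.
have [eqe|ne] := eqVneq [set a; b] [set x; y]; last first.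
  by apply: connect1; case/andP: aab => ab abE; rewrite adjE ab !inE ne.
have : a \in [set x; y] by rewrite -eqe !inE eqxx.
have : b \in [set x; y] by rewrite -eqe !inE eqxx orbT.
have /andP[ab _] := aab.
rewrite !inE => /pred2P[] eb /pred2P[] ea; move: ab; rewrite ea eb ?eqxx //.
by rewrite connect_adj_sym.
Qed.

Lemma connected_reaches_cycle V E c :
    (forall x y, x \in V -> y \in V -> connect (adj E) x y) ->
    {subset c <= V} -> is_cycle E c ->
  reaches V (E :\: cycle_edges c) [set x in c].
Proof.
move=> cVE cV cyc x xV; have [y yc] := is_cycle_head cyc.
apply: (@reach_avoiding _ _ _ x y); rewrite ?cycle_edges_powerset ?inE //.
by apply: cVE => //; apply: cV.
Qed.

Lemma card_setD_cycle E c : is_cycle E c ->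
  #|E :\: cycle_edges c| + size c = #|E|.
Proof.
move=> cyc; rewrite -(card_cycle_edges cyc) addnC.
rewrite -(cardsID (cycle_edges c) E); congr (_ + _).
by rewrite (setIidPr (cycle_edges_subset cyc)).
Qed.

Lemma card_cycle_vertices E c : is_cycle E c -> #|[set x in c]| = size c.
Proof. by case/and3P=> _ _ uc; rewrite cardsE; apply/card_uniqP. Qed.

(** Instance of card_reaches for the edges outside c and the vertices of c: the
    cycle has as many edges as vertices, so its length cancels. *)
Lemma connected_cycle_card V E c :
    (forall x y, x \in V -> y \in V -> connect (adj E) x y) ->
    {subset c <= V} -> is_cycle E c -> #|V| <= #|E|.
Proof.
move=> cVE cV cyc; have := card_reaches (connected_reaches_cycle cVE cV cyc).
by rewrite (card_cycle_vertices cyc) (card_setD_cycle cyc).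
Qed.

(** * Connected graphs with as many edges as vertices *)

Section Unicyclic.
Variables (V : {set T}) (E : {set {set T}}) (c : seq T).
Hypotheses (EV : E \subset powerset V) (VE_conn : connected V E).
Hypotheses (leEV : #|E| <= #|V|) (cyc : is_cycle E c).

Let cV : {subset c <= V} := cycle_vertices_subset EV cyc.
Let reach_c : reaches V (E :\: cycle_edges c) [set x in c] :=
  connected_reaches_cycle VE_conn.2 cV cyc.

(** An edge of c1 outside c2 could be deleted: the graph would stay connected
    and keep the cycle c2, with fewer edges than connected_cycle_card permits. *)
Lemma unicyclic_edges_sub c1 c2 :
  is_cycle E c1 -> is_cycle E c2 -> cycle_edges c1 \subset cycle_edges c2.
Proof.
move=> cyc1 cyc2; apply: contraLR leEV => /subsetPn[e e1 e2].
have cyc2' : is_cycle (E :\ e) c2.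
  have /and3P[sz cy uc] := cyc2; rewrite /is_cycle sz uc andbT /=.
  have all2 : all (mem c2) c2 by apply/allP.
  apply/(@sub_in_cycle _ (mem c2) (fun x y => next c2 x == y)) => //;
    last exact: cycle_next.
  move=> x y xc _ /eqP <-; have /andP[ne xE] := next_cycle cy xc.
  rewrite adjE ne !inE xE andbT.
  by apply: contraNneq e2 => <-; apply: imset_f.
have eE : e \in E by apply: subsetP e1; apply: cycle_edges_subset.
rewrite -ltnNge (cardsD1 e E) eE ltnS.
apply: connected_cycle_card (cyc2') => [x y xV yV|].
  by apply: (cycle_edge_removal cyc1 e1); apply: VE_conn.2.
exact: cycle_vertices_subset EV cyc2.
Qed.

Lemma unicyclic : unique_cycle E c.
Proof.
split=> // c' cyc'; apply/eqP.
by rewrite eqEsubset !unicyclic_edges_sub.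
Qed.

(** A cycle among the remaining edges would be a cycle of E, hence equal to c,
    but it uses none of the edges of c. *)
Lemma unicyclic_acyclic : acyclic (E :\: cycle_edges c).
Proof.
move=> c'; apply/negP => cyc'.
have cyc'E := is_cycle_subset (subsetDl E (cycle_edges c)) cyc'.
have [x xc'] := is_cycle_head cyc'.
have exc' : [set x; next c' x] \in cycle_edges c' by apply: imset_f.
have := subsetP (cycle_edges_subset cyc') _ exc'.
by rewrite inE -(unicyclic.2 _ cyc'E) exc'.
Qed.

(** If distinct u and v were joined outside the cycle, then every vertex would
    still reach the cycle vertices other than u, one fewer than the count
    requires. *)
Lemma unicyclic_cycle_vertices_separated u v :
    u \in c -> v \in c -> connect (adj (E :\: cycle_edges c)) u v -> u = v.
Proof.
move=> uc vc cuv; apply/eqP; apply: contraLR leEV => ne.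
have := @card_reaches V (E :\: cycle_edges c) ([set x in c] :\ u).
have := cardsD1 u [set x in c]; rewrite inE uc (card_cycle_vertices cyc).
rewrite -(card_setD_cycle cyc) => -> H; rewrite -ltnNge add1n addnS ltnS H //.
move=> x /reach_c[s sc cxs].
have [eqs|nes] := eqVneq s u; last first.
  by exists s; rewrite // in_setD1 nes.
exists v; first by rewrite !inE eq_sym ne.
by apply: connect_trans cuv; rewrite -eqs.
Qed.

Lemma unicyclic_odd_cycle_with_trees :
  odd (size c) -> odd_cycle_with_trees V E.
Proof.
move=> oc; split=> //; exists c; split=> //.
- exact: unicyclic.
- exact: unicyclic_acyclic.
set E' := E :\: cycle_edges c => K KE'.
have E'V : E' \subset powerset V by apply: subset_trans EV; apply: subsetDl.
split.
  split; first exact: component_connected E'V KE'.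
  move=> c'; apply: contra (unicyclic_acyclic c').
  by apply: is_cycle_subset; apply/subsetP => e; rewrite !inE => /andP[].
have [r rV defK] := imsetP KE'.
have [s] := reach_c rV; rewrite inE => sc crs.
suff -> : K :&: [set x in c] = [set s] by rewrite cards1.
apply/setP=> x; rewrite defK !inE; apply/andP/eqP => [[/andP[_ crx] xc]|->].
  apply: unicyclic_cycle_vertices_separated => //.
  by apply: connect_trans crs; rewrite connect_adj_sym.
by rewrite cV // crs.
Qed.

End Unicyclic.

(** * Odd closed walks and the double cover *)

Lemma not_uniq_split c :
  ~~ uniq c -> exists x p1 p2 p3, c = p1 ++ x :: p2 ++ x :: p3.
Proof.
elim: c => //= y c IHc; have [yc _|_ /IHc] := boolP (y \in c).
  by have [p2 p3] := splitPr yc; exists y, [::], p2, p3.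
by move=> [x [p1 [p2 [p3 ->]]]]; exists x, (y :: p1), p2, p3.
Qed.

(** A closed walk that repeats a vertex splits there into two shorter closed
    walks, one of which is odd. An odd closed walk without repetition has length
    at least 3 because the adjacency relation is irreflexive. *)
Lemma odd_closed_walk E c :
    cycle (adj E) c -> odd (size c) ->
  exists c', is_cycle E c' /\ odd (size c').
Proof.
have [n] := ubnP (size c); elim: n c => // n IHn c ltc cyc oc.
have [uc|/not_uniq_split[x [p1 [p2 [p3 def_c]]]]] := boolP (uniq c).
  exists c; rewrite /is_cycle cyc uc andbT; split=> //.
  by case: c cyc oc {ltc uc} => [|x [|y [|z p]]] //=; rewrite adjE eqxx.
have [cyc1 cyc2] : cycle (adj E) (x :: p2) /\ cycle (adj E) (x :: p3 ++ p1).
  move: cyc; rewrite def_c -(rot_cycle (size p1)) rot_size_cat /=.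
  by rewrite -cat_rcons -catA rcons_cat cat_path last_rcons => /andP[-> ->].
have szc : size c = size (x :: p2) + size (x :: p3 ++ p1).
  by rewrite def_c /= !size_cat /= size_cat /=; lia.
move: oc; rewrite szc oddD.
have [o2 _|_ /= o3] := boolP (odd (size (x :: p2))).
  by apply: IHn cyc1 o2; move: szc ltc => /=; lia.
by apply: IHn cyc2 o3; move: szc ltc => /=; lia.
Qed.

(** The bipartite double cover of the graph: each step switches the boolean,
    which thus records the parity of the length of a walk. *)
Definition double_cover E : rel (T * bool) :=
  [rel u v | adj E u.1 v.1 && (v.2 == ~~ u.2)].

Lemma double_cover_path E (u : T * bool) q :
    path (double_cover E) u q ->
  path (adj E) u.1 (map fst q) /\ (last u q).2 = odd (size q) (+) u.2.
Proof.
elim: q u => //= v q IHq u /andP[/andP[auv /eqP v2] /IHq[-> ->]].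
by rewrite auv v2 addbN addNb.
Qed.

Lemma double_cover_step E (u : T * bool) x y b :
    adj E x y ->
  connect (double_cover E) u (x, b) = connect (double_cover E) u (y, ~~ b).
Proof.
move=> axy; apply/idP/idP => cu; apply: connect_trans cu (connect1 _).
  by apply/andP; split.
by apply/andP; split; rewrite /= ?negbK // -/(adj E y x) adj_sym.
Qed.

Lemma odd_closed_walk_of_cover E r :
    connect (double_cover E) (r, false) (r, true) ->
  exists p, [/\ path (adj E) r p, last r p = r & odd (size p)].
Proof.
move=> /connectP[q /double_cover_path[/= pq] + eql].
rewrite -eql /= addbF => oq.
exists (map fst q); split=> //; last by rewrite size_map -oq.
by rewrite (last_map fst q (r, false)) -eql.
Qed.

End GraphTheory.

(** * Admissible line complexes *)

Import GRing.Theory.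
Local Open Scope ring_scope.

Lemma line_pair (L : {set point}) :
  L \in lines -> exists x y, x != y /\ L = [set x; y].
Proof.
rewrite inE => /existsP[x /existsP[v /andP[v0 /eqP->]]].
exists x, (x + v); split=> //.
by rewrite -subr_eq0 opprD addNKr oppr_eq0.
Qed.

(** Otherwise the indicator of the points at the end of an even walk from r,
    minus that of the points at the end of an odd walk, is a nonzero element of
    the kernel: one step along a line exchanges the two indicators, so the
    values at the two points of the line cancel, while the value at r is
    1 - 0. *)
Lemma admissible_cover (R : realType) (C : {set {set point}}) (r : point) :
    C \subset lines -> admissible R C ->
  connect (double_cover C) (r, false) (r, true).
Proof.
move=> /subsetP Cl adm; apply: contraT => nrr.
pose g b x := connect (double_cover C) (r, false) (x, b).
pose f : {ffun point -> R[i]} := [ffun x => (g false x)%:R - (g true x)%:R].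
have : f = [ffun=> 0].
  apply: adm; apply/ffunP=> -[L LC]; rewrite !ffunE /=.
  have [x [y [xy def_L]]] := line_pair (Cl L LC).
  rewrite def_L !big_setU1 ?inE // !big_set1 !ffunE /g.
  have axy : adj C x y by rewrite adjE xy -def_L.
  by rewrite !(double_cover_step _ _ axy) /= subrKA subrr addr0.
move=> /ffunP/(_ r); rewrite !ffunE /g connect0 (negPf nrr) subr0 => /eqP.
by rewrite oner_eq0.
Qed.

Lemma admissible_odd_cycle (R : realType) (C : {set {set point}}) K :
    C \subset lines -> admissible R C -> K \in components [set: point] C ->
  exists c, is_cycle (C ::&: K) c /\ odd (size c).
Proof.
move=> Cl adm KC.
have CT : C \subset powerset [set: point] by rewrite powersetT subsetT.
have [/set0Pn[r rK] _] := component_connected CT KC.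
have [p [pp eql op]] := odd_closed_walk_of_cover (admissible_cover r Cl adm).
have {pp} := path_restrict (component_closed CT KC) rK pp.
case/lastP: p eql op => // p x; rewrite last_rcons => -> op pp.
by apply: odd_closed_walk (pp : cycle _ (r :: p)) _; rewrite size_rcons in op.
Qed.

Local Close Scope ring_scope.

(** A nonempty edge lies in at most one of a family of disjoint sets. *)
Lemma sum_induced_edges (T : finType) (E P : {set {set T}}) :
  trivIset P -> set0 \notin E -> \sum_(K in P) #|E ::&: K| <= #|E|.
Proof.
move=> /trivIsetP tP E0.
under eq_bigr do rewrite -sum1_card big_mkcond.
rewrite exchange_big /= -sum1_card [leqRHS]big_mkcond; apply: leq_sum => e _.
case eE: (e \in E); last by rewrite big1 // => K _; rewrite inE eE.
have [/existsP[K /andP[KP eK]]|/existsPn none] :=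
    boolP [exists K, (K \in P) && (e \subset K)]; last first.
  rewrite big1 // => K KP; rewrite !inE eE /=.
  by have := none K; rewrite KP /= => /negPf->.
rewrite (bigD1 K) //= big1 => [|K' /andP[K'P ne]]; first by case: ifP.
rewrite !inE eE /= ifN //; apply: contraNN E0 => eK'.
suff <- : e = set0 by [].
apply/eqP; rewrite -subset0 -(disjoint_setI0 (tP _ _ K'P KP ne)).
by rewrite subsetI eK'.
Qed.

(** There are no more edges than vertices in total, so no component can have a
    surplus when none has a deficit. *)
Lemma component_edges_le (T : finType) (E : {set {set T}}) :
    set0 \notin E -> #|E| <= #|T| ->
    (forall K, K \in components setT E -> #|K| <= #|E ::&: K|) ->
  forall K, K \in components setT E -> #|E ::&: K| <= #|K|.
Proof.
move=> E0 leET leK K KE; have part := components_partition setT E.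
have /and3P[_ tI _] := part.
have := leq_trans (sum_induced_edges tI E0) leET.
rewrite -cardsT (card_partition part) (bigD1 K) //= [leqRHS](bigD1 K) //=.
set rest := \sum_(K' in components setT E | K' != K) #|K'| => le_tot.
have le_rest : rest <= \sum_(K' in components setT E | K' != K) #|E ::&: K'|.
  by apply: leq_sum => K' /andP[/leK].
by rewrite -(leq_add2r rest) (leq_trans _ le_tot) // leq_add2l.
Qed.

(* The edge set of G(C) is C itself, its vertex set is [set: point]. *)
Theorem mainTheorem4 (R : realType) (C : {set {set point}})
    (C_lines : C \subset lines) (C_adm : admissible R C) (C_card : #|C| = 16) :
  forall K : {set point}, K \in components [set: point] C ->
    odd_cycle_with_trees K (C ::&: K).
Proof.
have CT : C \subset powerset [set: point] by rewrite powersetT subsetT.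
have sub K : C ::&: K \subset powerset K.
  by apply/subsetP=> e; rewrite !inE => /andP[].
have C0 : set0 \notin C.
  apply/negP=> /(subsetP C_lines)/line_pair[x [y [_ /setP/(_ x)]]].
  by rewrite !inE eqxx.
have card_point : #|point| = 16 by rewrite card_mx card_ord.
have le_edges K : K \in components [set: point] C -> #|K| <= #|C ::&: K|.
  move=> KC; have [c [cyc _]] := admissible_odd_cycle C_lines C_adm KC.
  have cK := cycle_vertices_subset (sub K) cyc.
  exact: connected_cycle_card (component_connected CT KC).2 cK cyc.
move=> K KC; have [c [cyc oc]] := admissible_odd_cycle C_lines C_adm KC.
apply: unicyclic_odd_cycle_with_trees cyc oc => //.
  exact: component_connected CT KC.
by apply: component_edges_le => //; rewrite C_card card_point.
Qed.
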